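(* Let $\mu,\nu$ be (positive) partitions. The one-variable skew spin $q$-Whittaker polynomials are given by $$ \mathbb{F}_{\mu/\nu}(x)= x^{|\mu|-|\nu|}\prod_{i\ge1} \frac{(-s/x;q)_{\mu_i-\nu_i}\,(-sx;q)_{\nu_i-\mu_{i+1}}\,(q;q)_{\mu_i-\mu_{i+1}}} {(q;q)_{\mu_i-\nu_i}\,(q;q)_{\nu_i-\mu_{i+1}}\,(s^2;q)_{\mu_i-\mu_{i+1}}} \quad\text{if }\mu\succ\nu, $$ and $\mathbb{F}_{\mu/\nu}(x)=0$ otherwise; the dual ones are given by $$ \mathbb{F}^{*}_{\mu/\nu}(x)= x^{|\mu|-|\nu|}\prod_{i\ge1} \frac{(-s/x;q)_{\mu_i-\nu_i}\,(-sx;q)_{\nu_i-\mu_{i+1}}\,(q;q)_{\nu_i-\nu_{i+1}}} {(q;q)_{\mu_i-\nu_i}\,(q;q)_{\nu_i-\mu_{i+1}}\,(s^2;q)_{\nu_i-\nu_{i+1}}} \quad\text{if }\mu\succ\nu, $$ and $\mathbb{F}^{*}_{\mu/\nu}(x)=0$ otherwise.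
   Context: Fix $q,s\in\mathbb{C}$ with $|q|<1$, $|s|<1$. Write $(a;q)_m=\prod_{i=1}^m(1-aq^{i-1})$ for $m\ge 1$, $(a;q)_0=1$, $(a;q)_\infty=\prod_{i\ge1}(1-aq^{i-1})$. A (positive) partition is a finite, possibly empty, sequence $\lambda_1\ge\dots\ge\lambda_\ell\ge1$ of integers; $\ell(\lambda)=\ell$; $\lambda_i:=0$ for $i>\ell(\lambda)$; $|\lambda|=\sum_i\lambda_i$. We write $\lambda\succ\mu$ ($\lambda$ interlaces $\mu$) if $0\le\ell(\lambda)-\ell(\mu)\le1$ and $\lambda_i\ge\mu_i\ge\lambda_{i+1}$ for all $1\le i\le\ell(\mu)$ (the final inequality $\mu_{\ell(\mu)}\ge\lambda_{\ell(\mu)+1}$ being omitted when $\ell(\lambda)=\ell(\mu)$). Vertex weights: for $x\in\mathbb{C}$ and $i,j,k,\ell\in\mathbb{Z}_{\ge0}$, $$W_x(i,j;k,\ell)=\mathbf 1_{i+j=k+\ell}\,\mathbf 1_{i\ge\ell}\;x^\ell\frac{(-s/x;q)_\ell\,(-sx;q)_{i-\ell}\,(q;q)_k}{(q;q)_\ell\,(q;q)_{i-\ell}\,(s^2;q)_k},$$ where, here and in the claim, $x^\ell(-s/x;q)_\ell$ is read as the polynomial $\prod_{r=0}^{\ell-1}(x+sq^r)$. ($i,j,k,\ell$ are the numbers of paths on the bottom, left, top, right edges of the vertex.) Skew spin $q$-Whittaker polynomial: for partitions $\lambda,\mu$, $$\mathbb{F}_{\lambda/\mu}(x_1,\dots,x_n)=\sum\prod_{r=1}^n\left[x_r^{h_{r,0}}\frac{(-s/x_r;q)_{h_{r,0}}}{(q;q)_{h_{r,0}}}\prod_{c\ge1}W_{x_r}\big(v_{r-1,c},h_{r,c-1};v_{r,c},h_{r,c}\big)\right],$$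 the sum running over all non-negative integers $h_{r,c}$ ($1\le r\le n$, $c\ge0$), with $h_{r,c}=0$ for all large $c$, and $v_{r,c}$ ($0\le r\le n$, $c\ge1$) subject to $v_{0,c}=\mu_c-\mu_{c+1}$ and $v_{n,c}=\lambda_c-\lambda_{c+1}$; all but finitely many vertex weights equal $W_x(0,0;0,0)=1$ in any nonzero term. (Equivalently: the partition function on columns $0,1,2,\dots$ and rows $1,\dots,n$ numbered from bottom to top, row $r$ carrying $x_r$, all left and right boundary edges empty, infinitely many paths in column $0$ with weights $W_x(\infty,0;\infty,\ell)=x^\ell\frac{(-s/x;q)_\ell(-sx;q)_\infty}{(q;q)_\ell(s^2;q)_\infty}$, divided by $\prod_{i=1}^n(-sx_i;q)_\infty/(s^2;q)_\infty$.) Dual polynomials: $$\mathbb{F}^*_{\lambda/\mu}(x_1,\dots,x_n)=\frac{\tilde c_{\lambda'}}{\tilde c_{\mu'}}\,\mathbb{F}_{\lambda/\mu}(x_1,\dots,x_n),\qquad \tilde c_{\lambda'}=\prod_{i\ge1}\frac{(s^2;q)_{\lambda_i-\lambda_{i+1}}}{(q;q)_{\lambda_i-\lambda_{i+1}}}.$$ *)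

(* Defs.v *)
From mathcomp Require Import all_boot all_order all_algebra.
From mathcomp Require Import boolp classical_sets functions cardinality fsbigop.
From mathcomp Require Import reals.
From mathcomp.real_closed Require Export complex.

Set Implicit Arguments.
Unset Strict Implicit.
Unset Printing Implicit Defensive.

Import Order.TTheory GRing.Theory Num.Theory.

Local Open Scope classical_set_scope.
Local Open Scope ring_scope.

(* Partitions are sequences of naturals indexed from 0: lambda_i is
   [part la i.-1], and [part] is 0 beyond the length. *)
Definition is_partition (la : seq nat) : bool :=
  sorted geq la && all (leq 1) la.

Definition part (la : seq nat) (i : nat) : nat := nth 0%N la i.

(* Number of columns of length i.+1 in the Young diagram of [la]; the
   truncated subtraction is exact when [la] is a partition. *)
Definition mult (la : seq nat) (i : nat) : nat := (part la i - part la i.+1)%N.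

(* The upper constraint mu_i >= la_(i+1) is only imposed when la has an
   (i+1)-st part, i.e. it is omitted at i = l(mu) if l(la) = l(mu). *)
Definition interlaces (la mu : seq nat) : bool :=
  (size mu <= size la <= (size mu).+1)%N &&
  [forall i : 'I_(size mu),
     (part mu i <= part la i)%N &&
     ((i.+1 < size la)%N ==> (part la i.+1 <= part mu i)%N)].

Section SpinWhittaker.
Variable K : fieldType.
Implicit Types (q s x a : K) (la mu : seq nat).

Definition qpoch q a (m : nat) : K := \prod_(i < m) (1 - a * q ^+ i).

(* The polynomial x^l (-s/x; q)_l, which makes sense at x = 0 as well. *)
Definition xpoch q s x (l : nat) : K := \prod_(r < l) (x + s * q ^+ r).

Lemma xpochE q s x l : x != 0 -> xpoch q s x l = x ^+ l * qpoch q (- s / x) l.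
Proof.
move=> x0; rewrite /xpoch /qpoch -[in x ^+ l](card_ord l) -prodr_const.
rewrite -big_split /=; apply: eq_bigr => i _.
by rewrite mulrBr mulr1 mulNr mulNr mulrN opprK mulrA mulrCA divff // mulr1.
Qed.

Definition vertexW q s x (i j k l : nat) : K :=
  ((i + j == k + l)%N && (l <= i)%N)%:R *
  (xpoch q s x l * qpoch q (- s * x) (i - l) * qpoch q q k /
   (qpoch q q l * qpoch q q (i - l) * qpoch q (s ^+ 2) k)).

Definition eventually0 (f : nat -> nat) : Prop :=
  exists N : nat, forall c : nat, (N <= c)%N -> f c = 0%N.

(* Edge configurations (h, v) of the rows 1..n (the row r+1 has index r : 'I_n).
   [h r c] is the horizontal edge leaving column c >= 0, while [v r c] is the
   vertical edge in column c.+1 (column 0 carries no vertical variable).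
   Requiring every [v r] to be eventually 0 discards only configurations of
   weight 0: as [h] and [v ord0] vanish in all far columns, so does the next
   [v r] by path conservation, row by row. It ensures that the product over the
   columns in [skewF] has finitely many factors different from 1. *)
Definition configs (n : nat) la mu :
    set (('I_n -> nat -> nat) * ('I_n.+1 -> nat -> nat)) :=
  [set hv | [/\ forall r, eventually0 (hv.1 r),
                forall r, eventually0 (hv.2 r),
                hv.2 ord0 = mult mu &
                hv.2 ord_max = mult la]].

(* F_{la/mu}(x_1, ..., x_n). Both big operators with [\in] are the finite-support
   ones: for given boundary data only finitely many configurations have nonzero
   weight, since [v] and conservation bound all the edges. *)
Definition skewF q s (n : nat) la mu (x : n.-tuple K) : K :=
  \sum_(hv \in @configs n la mu)
    \prod_(r < n)
      (xpoch q s (tnth x r) (hv.1 r 0%N) / qpoch q q (hv.1 r 0%N) *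
       \big[*%R/1]_(c \in [set: nat])
          vertexW q s (tnth x r)
            (hv.2 (widen_ord (leqnSn n) r) c) (hv.1 r c)
            (hv.2 (lift ord0 r) c) (hv.1 r c.+1)).

(* The constant c~_{la'}, written in terms of la itself. *)
Definition ctilde q s la : K :=
  \big[*%R/1]_(i \in [set: nat])
     (qpoch q (s ^+ 2) (mult la i) / qpoch q q (mult la i)).

Definition skewFdual q s (n : nat) la mu (x : n.-tuple K) : K :=
  ctilde q s la / ctilde q s mu * skewF q s la mu x.

End SpinWhittaker.

(* Main.v *)
(* With one row, path conservation telescopes over the columns: since all edges
   are eventually empty, the horizontal edge leaving column c must carry
   la_(c+1) - mu_(c+1) paths. So at most one configuration has nonzero weight,
   and non-negativity of its edges together with the condition i >= l at each
   vertex is exactly interlacing. *)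
Require Import Defs.
From mathcomp Require Import all_boot all_order all_algebra.
From mathcomp Require Import boolp classical_sets functions cardinality fsbigop.
From mathcomp Require Import reals.
From mathcomp Require Import zify ring.

Set Implicit Arguments.
Unset Strict Implicit.
Unset Printing Implicit Defensive.

Import Order.TTheory GRing.Theory Num.Theory.

Local Open Scope classical_set_scope.
Local Open Scope ring_scope.

Lemma part_default la i : (size la <= i)%N -> part la i = 0%N.
Proof. by move=> ?; rewrite /part nth_default. Qed.

Lemma mult_default la c : (size la <= c)%N -> mult la c = 0%N.
Proof. by move=> lac; rewrite /mult part_default. Qed.

Lemma part_gt0 la i : is_partition la -> (i < size la)%N -> (0 < part la i)%N.
Proof. by case/andP=> _ /allP la1 ila; apply/la1/mem_nth. Qed.

Lemma part_anti la i : is_partition la -> (part la i.+1 <= part la i)%N.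
Proof.
case/andP=> la_sorted _; have [ila|lai] := ltnP i.+1 (size la); last first.
  by rewrite part_default.
exact: (sortedP 0%N la_sorted).
Qed.

(** Parts beyond the length read as 0 while genuine parts are positive, so the inequalities at
    [i = size la] and [i = size mu] already force the two length bounds. *)
Lemma interlacesP la mu : is_partition la -> is_partition mu ->
  reflect (forall i, part mu i <= part la i /\ part la i.+1 <= part mu i)%N
          (interlaces la mu).
Proof.
move=> la_part mu_part; apply: (iffP andP) => [[/andP[mula lamu] /forallP H] i|H].
  have [imu|mui] := ltnP i (size mu).
    have /andP[-> /implyP H2] := H (Ordinal imu); split=> //.
    by have [/H2//|lai] := ltnP i.+1 (size la); rewrite part_default.
  by rewrite (part_default mui) (@part_default la i.+1) //; lia.
split; last by apply/forallP => i; have [-> ->] := H i; rewrite implybT.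
apply/andP; split; rewrite leqNgt; apply/negP => lt.
- by have := part_gt0 mu_part lt; have [] := H (size la); rewrite (@part_default la); lia.
- by have := part_gt0 la_part lt; have [] := H (size mu); rewrite (@part_default mu); lia.
Qed.

Lemma fsbig_nat_trunc (T : Type) (idx : T) (op : Monoid.com_law idx)
    (F : nat -> T) N : (forall i, (N <= i)%N -> F i = idx) ->
  \big[op/idx]_(i \in [set: nat]) F i = \big[op/idx]_(i < N) F i.
Proof.
move=> F1; rewrite fsbig_ord; apply/esym/fsbig_widen => // i [_ /= /negP].
by rewrite -leqNgt; exact: F1.
Qed.

(* Conservation at each vertex says that [part la c - part mu c - h c] does not
   depend on [c], and it vanishes for large [c]. *)
Lemma conservation_hedge la mu (h : nat -> nat) :
    is_partition la -> is_partition mu -> eventually0 h ->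
    (forall c, mult mu c + h c = mult la c + h c.+1)%N ->
  forall c, (part mu c + h c = part la c)%N.
Proof.
move=> la_part mu_part [N hN] cons c.
(* Downward induction on [c], starting from a column beyond which [h] and both partitions vanish. *)
have [d le_d] := ubnP (N + size la + size mu - c).
elim: d c le_d => // d IHd c le_d.
have [le_c|lt_c] := leqP (N + size la + size mu) c.
  by rewrite hN ?part_default //; lia.
have := IHd c.+1; have := cons c; rewrite /mult.
have := part_anti c la_part; have := part_anti c mu_part.
by lia.
Qed.

Section OneRow.
Variable K : fieldType.
Implicit Types (q s x a : K) (la mu : seq nat).

Lemma qpoch0 q a : qpoch q a 0 = 1.
Proof. by rewrite /qpoch big_ord0. Qed.

Lemma xpoch0 q s x : xpoch q s x 0 = 1.
Proof. by rewrite /xpoch big_ord0. Qed.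

Lemma vertexW0 q s x : vertexW q s x 0 0 0 0 = 1.
Proof. by rewrite /vertexW subnn xpoch0 !qpoch0 !(mulr1, invr1). Qed.

Lemma vertexW_neq0 q s x i j k l : vertexW q s x i j k l != 0 ->
  (i + j = k + l)%N /\ (l <= i)%N.
Proof.
by rewrite /vertexW; case: andP => [[/eqP]|_] //; rewrite mul0r eqxx.
Qed.

Definition row_weight q s x (u h v : nat -> nat) : K :=
  xpoch q s x (h 0%N) / qpoch q q (h 0%N) *
  \big[*%R/1]_(c \in [set: nat]) vertexW q s x (u c) (h c) (v c) (h c.+1).

(** Eventual emptiness turns the product over all columns, which would default to 1 on infinite
    support, into a genuine finite product; in a field every vertex factor is then nonzero. *)
Lemma row_weight_neq0 q s x u h v :
    eventually0 u -> eventually0 h -> eventually0 v ->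
    row_weight q s x u h v != 0 ->
  forall c, (u c + h c = v c + h c.+1)%N /\ (h c.+1 <= u c)%N.
Proof.
move=> [Nu u0] [Nh h0] [Nv v0]; set N := (Nu + Nh + Nv)%N.
have zero c : (N <= c)%N -> [/\ u c = 0, h c = 0, v c = 0 & h c.+1 = 0]%N.
  by move=> le_c; rewrite u0 ?h0 ?v0 //; lia.
rewrite /row_weight (@fsbig_nat_trunc _ _ _ _ N); last first.
  by move=> c /zero[-> -> -> ->]; rewrite vertexW0.
rewrite mulf_eq0 negb_or => /andP[_ /prodf_neq0 W0] c.
have [lt_c|/zero[-> -> -> ->] //] := ltnP c N.
exact: vertexW_neq0 (W0 (Ordinal lt_c) isT).
Qed.

Lemma row_weight_interlacing q s x la mu :
    is_partition la -> is_partition mu -> interlaces la mu ->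
  row_weight q s x (mult mu) (fun c => part la c - part mu c)%N (mult la) =
  \big[*%R/1]_(i \in [set: nat])
    (xpoch q s x (part la i - part mu i) *
     qpoch q (- s * x) (part mu i - part la i.+1) *
     qpoch q q (mult la i) /
     (qpoch q q (part la i - part mu i) *
      qpoch q q (part mu i - part la i.+1) *
      qpoch q (s ^+ 2) (mult la i))).
Proof.
move=> la_part mu_part /(interlacesP la_part mu_part) H.
set N := (size la + size mu)%N.
have zero c : (N <= c)%N ->
    [/\ part la c = 0, part mu c = 0, mult la c = 0 & mult mu c = 0]%N.
  by move=> le_c; rewrite !mult_default ?part_default //; lia.
have zeroS c : (N <= c)%N -> part la c.+1 = 0%N /\ part mu c.+1 = 0%N.
  by move=> le_c; rewrite !part_default //; lia.
rewrite /row_weight !(@fsbig_nat_trunc _ _ _ _ N); first last.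
- by move=> c le_c; have [-> -> -> ->] := zero c le_c; have [-> ->] := zeroS c le_c;
    rewrite vertexW0.
- move=> c le_c; have [-> -> -> _] := zero c le_c; have [-> _] := zeroS c le_c.
  by rewrite xpoch0 !qpoch0 !(mulr1, invr1).
pose g c := xpoch q s x (part la c - part mu c) / qpoch q q (part la c - part mu c).
(* Moving the factor of the horizontal edge leaving column 0 under the product
   pairs each vertex with its incoming instead of its outgoing edge. *)
have shift : g 0%N * \prod_(c < N) g c.+1 = \prod_(c < N) g c.
  (* The boundary factor [g N] equals 1, since both partitions have run out at [N]. *)
  have [gN _ _ _] := zero N (leqnn N).
  rewrite -(big_ord_recl N (fun c => g c)) big_ord_recr /= {2}/g gN sub0n xpoch0.
  by rewrite qpoch0 divr1 mulr1.
have vertexE c : vertexW q s x (mult mu c) (part la c - part mu c)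
      (mult la c) (part la c.+1 - part mu c.+1) =
    g c.+1 * (qpoch q (- s * x) (part mu c - part la c.+1) * qpoch q q (mult la c) /
     (qpoch q q (part mu c - part la c.+1) * qpoch q (s ^+ 2) (mult la c))).
  have [Hc1 Hc2] := H c; have [Hd1 Hd2] := H c.+1.
  (* The index [i - l] of the vertex: [part mu c.+1] cancels between the bottom edge and the
     outgoing edge. Interlacing makes the truncated subtractions exact. *)
  have -> : (part mu c - part la c.+1 =
             mult mu c - (part la c.+1 - part mu c.+1))%N by rewrite /mult; lia.
  rewrite /vertexW /g /mult.
  case: andP => [_|[]]; last by split; [apply/eqP|]; lia.
  by rewrite mul1r !invfM; ring.
under eq_bigr do rewrite vertexE.
rewrite big_split /= mulrA shift -big_split /=; apply: eq_bigr => c _.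
by rewrite /g !invfM; ring.
Qed.

Lemma skewF1 q s x la mu : is_partition la -> is_partition mu ->
  skewF q s la mu [tuple x] =
  if interlaces la mu then
    row_weight q s x (mult mu) (fun c => part la c - part mu c)%N (mult la)
  else 0.
Proof.
move=> la_part mu_part.
(* The only configuration that can have nonzero weight. *)
pose hv0 : ('I_1 -> nat -> nat) * ('I_2 -> nat -> nat) :=
  (fun _ c => (part la c - part mu c)%N,
   fun r => if r == ord0 then mult mu else mult la).
have ev_mult ka : eventually0 (mult ka).
  by exists (size ka) => c; exact: mult_default.
pose T (hv : ('I_1 -> nat -> nat) * ('I_2 -> nat -> nat)) :=
  row_weight q s x (hv.2 ord0) (hv.1 ord0) (hv.2 ord_max).
have -> : skewF q s la mu [tuple x] = \sum_(hv \in @configs 1 la mu) T hv.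
  apply: eq_fsbigr => hv _; rewrite big_ord1 /T /row_weight tnth0.
  by have [-> ->] : widen_ord (leqnSn 1) ord0 = ord0 /\ lift ord0 ord0 = ord_max :> 'I_2
    by split; exact: val_inj.
have support hv : configs la mu hv -> T hv != 0 -> interlaces la mu /\ hv = hv0.
  case: hv => h v [/= /(_ ord0) h0 _ v0 vmax]; rewrite /T /= v0 vmax => W0.
  have H := row_weight_neq0 (ev_mult mu) h0 (ev_mult la) W0.
  have hE := conservation_hedge la_part mu_part h0 (fun c => proj1 (H c)).
  split.
    apply/interlacesP => // c; split; first by rewrite -hE; lia.
    (* With [h c.+1] known, the vertex condition [h c.+1 <= mult mu c] becomes the second
       interlacing inequality. *)
    have [_] := H c; rewrite /mult; have := hE c.+1; have := part_anti c mu_part.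
    by lia.
  congr pair; apply: funext => r.
    by apply: funext => c; rewrite ord1 -hE addKn.
  case: eqP => [-> //|/eqP r0]; rewrite -vmax; congr v.
  by apply: val_inj; case: r r0 => [[|[|]]].
case: ifP => [inter|ninter]; last first.
  apply: fsbig1 => hv /support sup; apply/eqP/negPn/negP => /sup[].
  by rewrite ninter.
(* It remains that [hv0] is itself a configuration and that, by [support], all other terms
   vanish. *)
rewrite -(@fsbig_widen _ _ _ _ [set hv0]).
- by rewrite fsbig_set1.
- move=> _ ->; split=> //= [_|r].
    by exists (size la) => c lac; rewrite part_default.
  by case: ifP.
- move=> hv [/support sup /= hv_neq]; apply/eqP/negPn/negP => /sup[_].
  exact: hv_neq.
Qed.

(** The bound [N] is left free so that the constants of two partitions can be divided factor by
    factor over a common range. *)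
Lemma ctildeE q s la N : (size la <= N)%N ->
  ctilde q s la =
  \prod_(i < N) (qpoch q (s ^+ 2) (mult la i) / qpoch q q (mult la i)).
Proof.
move=> laN; apply: fsbig_nat_trunc => i Ni.
by rewrite mult_default ?(leq_trans laN) // !qpoch0 divr1.
Qed.

End OneRow.

(** Each [a * q ^+ i] has norm below 1, so no factor vanishes. Applied with [a = q] and
    [a = s ^+ 2], this permits the cancellations in the dual formula. *)
Lemma qpoch_neq0 (K : numFieldType) (q a : K) m :
  `|q| < 1 -> `|a| < 1 -> qpoch q a m != 0.
Proof.
move=> q1 a1; apply/prodf_neq0 => i _; rewrite subr_eq0 eq_sym.
have : `|a * q ^+ i| < 1.
  rewrite normrM normrX (le_lt_trans _ a1) // ler_piMr //.
  by rewrite exprn_ile1 // ltW.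
by apply: contraTneq => ->; rewrite normr1 ltxx.
Qed.

Theorem theorem6p2 (R : realType) (q s : R[i])
    (hq : `|q| < 1) (hs : `|s| < 1)
    (mu nu : seq nat) (hmu : is_partition mu) (hnu : is_partition nu)
    (x : R[i]) :
  skewF q s mu nu [tuple x] =
    (if interlaces mu nu then
       \big[*%R/1]_(i \in [set: nat])
         (xpoch q s x (part mu i - part nu i) *
          qpoch q (- s * x) (part nu i - part mu i.+1) *
          qpoch q q (part mu i - part mu i.+1) /
          (qpoch q q (part mu i - part nu i) *
           qpoch q q (part nu i - part mu i.+1) *
           qpoch q (s ^+ 2) (part mu i - part mu i.+1)))
     else 0)
  /\
  skewFdual q s mu nu [tuple x] =
    (if interlaces mu nu then
       \big[*%R/1]_(i \in [set: nat])
         (xpoch q s x (part mu i - part nu i) *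
          qpoch q (- s * x) (part nu i - part mu i.+1) *
          qpoch q q (part nu i - part nu i.+1) /
          (qpoch q q (part mu i - part nu i) *
           qpoch q q (part nu i - part mu i.+1) *
           qpoch q (s ^+ 2) (part nu i - part nu i.+1)))
     else 0).
Proof.
have s2 : `|s ^+ 2| < 1 by rewrite normrX exprn_ilt1.
rewrite /skewFdual skewF1 //; case: ifP => inter; last by rewrite mulr0.
rewrite row_weight_interlacing //; split=> //.
set N := (size mu + size nu)%N.
have zero i : (N <= i)%N -> [/\ part mu i = 0, part mu i.+1 = 0,
    part nu i = 0 & part nu i.+1 = 0]%N.
  by move=> Ni; rewrite !part_default //; lia.
rewrite !(@ctildeE _ _ _ _ N) ?leq_addl ?leq_addr // !(@fsbig_nat_trunc _ _ _ _ N).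
(* In the [i]-th factor the ratio of the constants cancels the quotient of [qpoch q q] by
   [qpoch q (s ^+ 2)] at [mult mu i] and puts in the one at [mult nu i]. *)
- rewrite -prodf_div -big_split /=; apply: eq_bigr => i _.
  rewrite -!/(mult _ _).
  have Q0 k : qpoch q q k != 0 by exact: qpoch_neq0.
  have S0 k : qpoch q (s ^+ 2) k != 0 by exact: qpoch_neq0.
  by field; rewrite ?Q0 ?S0.
- by move=> i /zero[-> -> -> ->]; rewrite xpoch0 !qpoch0 !(mulr1, invr1).
- by move=> i /zero[m0 mS0 n0 _]; rewrite /mult m0 mS0 n0 xpoch0 !qpoch0 !(mulr1, invr1).
Qed.
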